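(* Let $\kappa\in\{4,8\}$, let $m$ be a positive integer, and let $C_m\subset\mathbb{Z}^2$ be a nonempty $\kappa$-connected digital simple closed $\kappa$-curve with $m$ points. Then $$\mathrm{TC}(C_m,\kappa)=\begin{cases}1, & m<5,\\ 2, & m>5.\end{cases}$$
   Context: Digital images. A digital image $(X,\kappa)$ in $\mathbb{Z}^2$ is a finite subset $X\subset\mathbb{Z}^2$ with $\kappa\in\{4,8\}$: distinct points are $4$-adjacent if they differ by $1$ in exactly one coordinate and agree in the other, and $8$-adjacent if each coordinate differs by at most $1$. Write $x\leftrightarrow_\kappa y$ for adjacency. $X$ is $\kappa$-connected if any two distinct points are joined by a finite sequence of points of $X$ in which consecutive points are $\kappa$-adjacent. In $X\times X$, two distinct points are adjacent if in each factor their components are equal or $\kappa$-adjacent. A map is digitally continuous if adjacent points have adjacent or equal images. The digital interval $[a,b]_{\mathbb{Z}}=\{z\in\mathbb{Z}:a\le z\le b\}$ carries $2$-adjacency ($|x-y|=1$). Simple closed curves. For $m\ge4$, a digital image $(C,\kappa)$ is a digital simple closed $\kappa$-curve with $m$ points, denoted $C_m$, if there is a continuous bijection $f:[0,m-1]_{\mathbb{Z}}\to C$ with $f(0)\leftrightarrow_\kappa f(m-1)$ such that for every $t$ the only $\kappa$-neighbors of $f(t)$ in $C$ are $f((t-1)\bmod m)$ and $f((t+1)\bmod m)$. For $m=1,2,3$, $C_m$ denotes a one-point image, two adjacent points, and three mutually adjacent points respectively. ''Nonempty'' means that such a curve exists for the given $m$ and $\kappa$. Topological complexity. A digital path in $X$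 is a digitally continuous map $\alpha:[0,m]_{\mathbb{Z}}\to X$, $m\ge 0$ arbitrary. $PX$ is the set of all digital paths in $X$; two paths are adjacent if, after extending the one with fewer steps by repeating its last point so both have the same number of steps, their values at each $t$ are equal or $\kappa$-adjacent. Let $\pi:PX\to X\times X$, $\pi(\alpha)=(\alpha(0),\alpha(m))$. For $\kappa$-connected $X$, $\mathrm{TC}(X,\kappa)$ is the minimal $k$ such that $X\times X=U_1\cup\dots\cup U_k$ and for each $j$ there is a digitally continuous $s_j:U_j\to PX$ with $\pi\circ s_j=\mathrm{id}_{U_j}$ ($\infty$ if no such $k$ exists). *)

(* Defs.v *)
From HB Require Import structures.
From mathcomp Require Import all_boot all_order all_algebra.
From mathcomp Require Import finmap boolp.

Set Implicit Arguments.
Unset Strict Implicit.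
Unset Printing Implicit Defensive.

Import Order.TTheory GRing.Theory Num.Theory.

Local Open Scope fset_scope.

Notation Z2 := (int * int)%type.

Variant adjacency := Adj4 | Adj8.

Definition adj (kappa : adjacency) : rel Z2 := fun x y =>
  match kappa with
  | Adj4 => ((x.1 == y.1) && (`|x.2 - y.2|%R == 1%R)) ||
            ((x.2 == y.2) && (`|x.1 - y.1|%R == 1%R))
  | Adj8 => [&& x != y, (`|x.1 - y.1| <= 1)%R & (`|x.2 - y.2| <= 1)%R]
  end.

Definition digitally_continuous (S T : Type) (eS : rel S) (eT : rel T)
    (f : S -> T) : Prop :=
  forall x y : S, eS x y -> f x = f y \/ eT (f x) (f y).

(* The digital interval [0, n - 1] is 'I_n. *)
Definition interval_adj (n : nat) : rel 'I_n :=
  fun i j => (i.+1 == j :> nat) || (j.+1 == i :> nat).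

Section DigitalImage.

Variables (kappa : adjacency) (X : {fset Z2}).

Definition image_adj : rel X := relpre val (adj kappa).

Definition image_connected : Prop := forall x y : X, connect image_adj x y.

Definition prod_adj : rel (X * X) := fun p q =>
  [&& p != q, (p.1 == q.1) || image_adj p.1 q.1
            & (p.2 == q.2) || image_adj p.2 q.2].

Record dpath := DPath {
  steps : nat;
  dpath_fun :> 'I_steps.+1 -> X;
  dpath_continuous :
    digitally_continuous (@interval_adj steps.+1) image_adj dpath_fun
}.

(* The value at time t, repeating the last point beyond the number of steps. *)
Definition dpath_at (a : dpath) (t : nat) : X := a (inord (minn t (steps a))).

Definition dpath_adj : rel dpath := fun a b =>
  [forall t : 'I_(maxn (steps a) (steps b)).+1,
     (dpath_at a t == dpath_at b t) || image_adj (dpath_at a t) (dpath_at b t)].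

Definition endpoints (a : dpath) : X * X := (a ord0, a ord_max).

Definition has_section (U : {set X * X}) : Prop :=
  exists s : {p : X * X | p \in U} -> dpath,
    digitally_continuous (relpre val prod_adj) dpath_adj s /\
    forall p, endpoints (s p) = val p.

Definition motion_cover (k : nat) : Prop :=
  exists U : 'I_k -> {set X * X},
    (\bigcup_(j < k) U j)%SET = [set: X * X]%SET /\
    forall j, has_section (U j).

(* [None] stands for infinity. *)
Definition TC : option nat :=
  match pselect (exists k, `[< motion_cover k >]) with
  | left ex_cover => Some (ex_minn ex_cover)
  | right _ => None
  end.

Definition simple_closed_curve (m : nat) : Prop :=
  match m with
  | 0 => False
  | 1 => exists x, X = [fset x]
  | 2 => exists x y, X = [fset x; y] /\ adj kappa x y
  | 3 => exists x y z,
      X = [fset x; y; z] /\ [/\ adj kappa x y, adj kappa y z & adj kappa x z]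
  | n.+4 => exists f : 'I_n.+4 -> X,
      [/\ digitally_continuous (@interval_adj n.+4) image_adj f,
          bijective f,
          image_adj (f ord0) (f ord_max)
        & forall (t : 'I_n.+4) (y : X),
            image_adj (f t) y <-> y = f (ord_pred t) \/ y = f (ordS t)]
  end.

End DigitalImage.

(* Main.v *)
Require Import Defs.
From mathcomp Require Import zify.
From HB Require Import structures.
From mathcomp Require Import all_boot all_order all_algebra.
From mathcomp Require Import finmap boolp.

Set Implicit Arguments.
Unset Strict Implicit.
Unset Printing Implicit Defensive.

Import Order.TTheory GRing.Theory Num.Theory.

(** A curve with at most four points can be moved onto a set of mutually
    adjacent points by a map [r] that displaces every point by at most one step
    (the identity for at most three points; for the 4-cycle, folding one edge
    onto the opposite edge).  Then the path x, r x, r y, y depends continuously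
    on (x, y), so one motion planner suffices ([TC1_clique_retract]).

    A curve with m >= 4 points is handled through its universal cover: an
    m-periodic map from the integers onto the curve under which steps of size
    at most one correspond to adjacency or equality ([winding]).

    Two planners suffice for m >= 5.  Walking from x to y in the positive
    direction is continuous on the pairs whose positive distance is at most
    m - 3: neighbouring pairs have distances that agree up to 2 modulo m, and
    that bound excludes a jump between distance almost m and distance almost 0
    ([forward_section]).  The pairs left out are at negative distance 1 or 2,
    and the same result for the reversed orientation covers them
    ([motion_cover2]).

    One planner does not suffice for m >= 5.  Restricting a global section to
    the pairs (x, x0) and letting time run from 0 gives a sequence of
    continuous self-maps of the curve, successive ones pointwise adjacent or
    equal, from the identity to the constant x0.  The winding number of a
    self-map, m times its degree, is the sum of the signed steps made by the
    images of consecutive points.  Around a square of four nearby points the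
    signed steps add up to a multiple of m of absolute value at most 4, hence
    to 0 ([turn_square]); so the winding number does not change along such a
    sequence ([winding_number_homotopy]).  But it is m for the identity and 0
    for a constant map. *)

(** * Paths and continuity *)

Section MotionPlanning.

Variables (kappa : adjacency) (X : {fset Z2}).

(** Continuity, the adjacency of pairs and the adjacency of paths all refer to
    points that are adjacent or equal, so the argument runs on this reflexive
    closure of the adjacency. *)
Definition near (x y : X) : bool := (x == y) || image_adj kappa x y.

Lemma nearxx x : near x x.
Proof. by rewrite /near eqxx. Qed.

Lemma adj_sym : symmetric (adj kappa).
Proof.
move=> x y; case: kappa => /=.
  by rewrite ![ `|x.1 - _|%R]distrC ![ `|x.2 - _|%R]distrC ![x.1 == _]eq_sym
             ![x.2 == _]eq_sym.
by rewrite eq_sym [ `|x.1 - _|%R]distrC [ `|x.2 - _|%R]distrC.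
Qed.

Lemma near_sym : symmetric near.
Proof. by move=> x y; rewrite /near /image_adj /= eq_sym adj_sym. Qed.

Lemma nearP x y : reflect (x = y \/ image_adj kappa x y) (near x y).
Proof. exact: (iffP predU1P). Qed.

Lemma prod_adj_near p q :
  prod_adj kappa p q -> near p.1 q.1 /\ near p.2 q.2.
Proof. by case/and3P. Qed.

Lemma dpath_at_step (a : dpath kappa X) t : near (dpath_at a t) (dpath_at a t.+1).
Proof.
rewrite /dpath_at; case: (ltnP t (steps a)) => [lt_t | le_t]; last first.
  by rewrite !(minn_idPr _) ?nearxx // ltnW.
apply/nearP/dpath_continuous; rewrite /interval_adj !(minn_idPl _) ?(ltnW lt_t) //.
by rewrite !inordK ?eqxx // ltnS ltnW.
Qed.

Lemma dpath_at0 (a : dpath kappa X) : dpath_at a 0 = (endpoints a).1.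
Proof. by rewrite /dpath_at min0n; congr (a _); apply: val_inj; rewrite /= inordK. Qed.

Lemma dpath_at_end (a : dpath kappa X) t :
  steps a <= t -> dpath_at a t = (endpoints a).2.
Proof.
move=> le_t; rewrite /dpath_at (minn_idPr le_t).
by congr (a _); apply: val_inj; rewrite /= inordK.
Qed.

(** Beyond the longer of the two durations both paths rest at their endpoints,
    so the finitely many times tested by [dpath_adj] settle all times. *)
Lemma dpath_adj_at (a b : dpath kappa X) t :
  dpath_adj a b -> near (dpath_at a t) (dpath_at b t).
Proof.
move/forallP => adj_ab; set n := maxn (steps a) (steps b).
case: (ltnP t n.+1) => [lt_t | lt_n]; first exact: (adj_ab (Ordinal lt_t)).
have := adj_ab ord_max; rewrite !dpath_at_end //= ?leq_maxl ?leq_maxr //.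
  by apply: leq_trans (ltnW lt_n); apply: leq_maxr.
by apply: leq_trans (ltnW lt_n); apply: leq_maxl.
Qed.

Section PathOfWalk.

Variables (w : nat -> X) (n : nat).
Hypothesis w_step : forall t, near (w t) (w t.+1).

Lemma walk_continuous :
  digitally_continuous (@interval_adj n.+1) (@image_adj kappa X)
    (fun i : 'I_n.+1 => w i).
Proof.
move=> i j /orP[] /eqP <-; apply/nearP; first exact: w_step.
by rewrite near_sym; apply: w_step.
Qed.

Definition path_of_walk : dpath kappa X := DPath walk_continuous.

Lemma path_of_walk_at t : dpath_at path_of_walk t = w (minn t n).
Proof. by rewrite /dpath_at /= inordK // ltnS geq_minr. Qed.

End PathOfWalk.

(** Planners with a common duration [n] avoid all padding.  Adjacent pairs move
    in both coordinates at once, whence the two nearness hypotheses. *)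
Lemma walks_section (U : {set X * X}) (n : nat) (w : X * X -> nat -> X) :
    (forall p t, near (w p t) (w p t.+1)) ->
    (forall p, w p 0 = p.1) -> (forall p, w p n = p.2) ->
    (forall p q t, p \in U -> q \in U -> near p.1 q.1 -> near p.2 q.2 ->
       near (w p t) (w q t)) ->
  has_section kappa U.
Proof.
move=> w_step w0 wn w_near.
exists (fun p => path_of_walk n (w_step (val p))); split=> [p q | p].
  case/prod_adj_near=> near1 near2; right; apply/forallP => t.
  rewrite !path_of_walk_at; apply: w_near => //; exact: valP.
by rewrite /endpoints /= w0 wn -surjective_pairing.
Qed.

(** * Counting motion planners *)

Lemma motion_cover1 : motion_cover kappa X 1 <-> has_section kappa [set: X * X].
Proof.
split=> [[U [coverU sectU]] | sectT].
  by rewrite -coverU big_ord_recl big_ord0 setU0; apply: sectU.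
exists (fun=> setT); split=> //; by rewrite big_ord_recl big_ord0 setU0.
Qed.

Lemma motion_cover0 (x : X) : ~ motion_cover kappa X 0.
Proof.
case=> U [/setP/(_ (x, x))]; by rewrite big_ord0 !inE.
Qed.

Lemma TC_eq k :
    motion_cover kappa X k -> (forall j, j < k -> ~ motion_cover kappa X j) ->
  TC kappa X = Some k.
Proof.
move=> covk min_k; rewrite /TC; case: pselect => [ex | []]; last first.
  by exists k; apply/asboolP.
case: ex_minnP => j /asboolP covj min_j; congr Some.
apply/eqP; rewrite eqn_leq min_j ?andTb; last exact/asboolP.
by rewrite leqNgt; apply/negP => /min_k.
Qed.

(** The planner is the path x, r x, r y, y.  Its middle leg is a step because the
    image of [r] is a clique, and for the same reason the intermediate points of
    any two such paths are near each other. *)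
Lemma TC1_clique_retract (x0 : X) (r : X -> X) :
    (forall x, near x (r x)) -> (forall x y, near (r x) (r y)) ->
  TC kappa X = Some 1.
Proof.
move=> near_r r_clique; apply: TC_eq => [|[] // _]; last exact: motion_cover0.
apply/motion_cover1.
pose w (p : X * X) t := nth p.2 [:: p.1; r p.1; r p.2] t.
apply: (@walks_section _ 3 w) => // [p | p q] [|[|[|t]]] //=;
  rewrite /w /= ?nth_nil ?nearxx //.
by rewrite near_sym.
Qed.

(** * The universal cover of a cycle *)

(** A universal cover of [X], seen as a cycle of length [m].  Points are lifted
    to integers by the chosen section [unwrap]; [near_wrap] lifts steps. *)
Record winding (m : nat) := Winding {
  wrap :> int -> X;
  unwrap : X -> int;
  unwrapK : cancel unwrap wrap;
  wrap_eq : forall z z', (wrap z == wrap z') = (m %| (z' - z)%R)%Z;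
  wrap_near : forall z e, (`|e| <= 1)%R -> near (wrap z) (wrap (z + e)%R);
  near_wrap : forall z y, near (wrap z) y ->
    exists2 e, (`|e| <= 1)%R & y = wrap (z + e)%R
}.

Section WindingTheory.

Variables (m : nat) (W : winding m).

Lemma wrapD z z' c : W z = W z' -> W (z + c)%R = W (z' + c)%R.
Proof.
move/eqP; rewrite wrap_eq => dvd_m; apply/eqP.
by rewrite wrap_eq opprD addrACA subrr addr0.
Qed.

(** An integer identity between lifts can be checked on the curve as soon as both
    sides are known to differ by less than [m]. *)
Lemma wrap_inj_small z z' : W z = W z' -> (`|z' - z| < m%:Z)%R -> z = z'.
Proof.
move/eqP; rewrite wrap_eq => dvd_m lt_m.
have: (z' - z)%R = 0%R.
  move: dvd_m => /dvdzP[k eq_km]; move: lt_m; rewrite eq_km normrM.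
  case: (k =P 0%R) => [-> | k_neq0]; first by rewrite mul0r.
  by nia.
by lia.
Qed.

(** The cover with reversed orientation: each result about walking in the positive
    direction has its negative counterpart at no cost. *)
Definition mirror : winding m.
Proof.
refine (@Winding m (fun z => W (- z)%R) (fun x => - unwrap W x)%R _ _ _ _).
- by move=> x; rewrite opprK unwrapK.
- by move=> z z'; rewrite wrap_eq !dvdzE; congr (_ %| _)%N; lia.
- by move=> z e le_e1; rewrite opprD; apply: wrap_near; rewrite normrN.
move=> z y /near_wrap[e le_e1 ->]; exists (- e)%R; rewrite ?normrN //.
by rewrite opprD opprK.
Defined.

(** * Two planners suffice *)

Hypothesis m_ge3 : 3 <= m.

Definition gap (x y : X) : nat := `|((unwrap W y - unwrap W x)%R %% m)%Z|.

Lemma gap_lt x y : gap x y < m.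
Proof. rewrite /gap; have := @ltz_pmod (unwrap W y - unwrap W x)%R m; lia. Qed.

Lemma wrap_gap x y : W (unwrap W x + (gap x y)%:Z)%R = y.
Proof.
rewrite -[RHS](unwrapK W); apply/eqP; rewrite wrap_eq /gap gez0_abs; last first.
  by apply: modz_ge0; lia.
rewrite opprD addrA -eqz_mod_dvd; apply/eqP; by rewrite modz_mod.
Qed.

(** Both endpoints of a pair can move by one step, so the gap changes by at most 2
    up to a multiple of [m]; gaps bounded by m - 3 then change by at most 2 as
    integers.  At time t the walker sits over min (x + t, y), and a minimum of two
    numbers moves by at most one step if both do. *)
Lemma forward_section : has_section kappa [set p | gap p.1 p.2 + 3 <= m].
Proof.
pose w (p : X * X) t := W (unwrap W p.1 + (minn t (gap p.1 p.2))%:Z)%R.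
apply: (@walks_section _ m w) => [p t | p | p | p q t].
- rewrite /w; set d := gap _ _.
  pose e := ((minn t.+1 d)%:Z - (minn t d)%:Z)%R.
  rewrite (_ : (_ + (minn t.+1 d)%:Z)%R
             = (unwrap W p.1 + (minn t d)%:Z + e)%R); last by lia.
  by apply: wrap_near; lia.
- by rewrite /w min0n addr0 unwrapK.
- by rewrite /w (minn_idPr (ltnW (gap_lt _ _))) wrap_gap.
rewrite !inE /w; case: p q => [x y] [x' y'] /=.
have := wrap_gap x y; have := wrap_gap x' y'; have := unwrapK W x'.
move: (gap x y) (gap x' y') (unwrap W x') (unwrap W x) (unwrapK W x).
move=> d d' a' a Wa Wa' Wy' Wy le_d le_d'.
rewrite -{1}Wa -{1}Wy => /near_wrap[e le_e xE] /near_wrap[e' le_e' yE].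
(* The lift [a'] of [x'] is only congruent to [a + e]; all computations take
   place over the latter, which is close to [a]. *)
have shift c : W (a' + c)%R = W (a + e + c)%R by apply: wrapD; rewrite Wa'.
have d'E : (a + e + d')%R = (a + d + e')%R.
  by apply: wrap_inj_small; rewrite -?shift ?Wy' //; lia.
rewrite shift.
pose c := (e + (minn t d')%:Z - (minn t d)%:Z)%R.
rewrite (_ : (a + e + _)%R = (a + (minn t d)%:Z + c)%R); last by lia.
by apply: wrap_near; lia.
Qed.

End WindingTheory.

(** The two gaps of a pair, for the two orientations, add up to 0 or [m]; they cannot
    both exceed m - 3 unless 2 (m - 2) <= m, that is m <= 4. *)
Lemma motion_cover2 m (W : winding m) : 5 <= m -> motion_cover kappa X 2.
Proof.
move=> m_ge5; have m_ge3 : 3 <= m by lia.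
pose half (W' : winding m) := [set p : X * X | gap W' p.1 p.2 + 3 <= m].
exists (fun j : 'I_2 => if j == ord0 then half W else half (mirror W)).
split=> [|j]; last by case: ifP => _; apply: forward_section.
rewrite !big_ord_recl big_ord0 setU0 /=; apply/setP => -[x y]; rewrite !inE /=.
have := wrap_gap (mirror W) m_ge3 x y.
rewrite -[X in _ = X](wrap_gap W m_ge3 x y) /= => /eqP.
rewrite wrap_eq => /dvdzP[k].
have := gap_lt (mirror W) m_ge3 x y; have := gap_lt W m_ge3 x y.
move: (gap W x y) (gap (mirror W) x y) (unwrap W x) => d d' a lt_d lt_d' sumE.
have {}sumE : (d%:Z + d'%:Z = k * m%:Z)%R by lia.
have [k0|k1] : k = 0%R \/ k = 1%R by nia.
  by move: sumE; rewrite k0 mul0r; lia.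
by move: sumE; rewrite k1 mul1r; lia.
Qed.

(** * One planner does not suffice *)

Section WindingNumber.

Variables (m : nat) (W : winding m).
Hypothesis m_ge5 : 5 <= m.

(** The signed step from [x] to a near point [y]; when these points are near, the
    default value 0 is met only for [x = y]. *)
Definition turn (x y : X) : int :=
  if y == W (unwrap W x + 1)%R then 1%R
  else if y == W (unwrap W x - 1)%R then (-1)%R else 0%R.

Lemma wrapD_turn x y z : near x y -> x = W z -> y = W (z + turn x y)%R.
Proof.
move=> near_xy xE.
have shift c : W (unwrap W x + c)%R = W (z + c)%R.
  by apply: wrapD; rewrite unwrapK.
rewrite -shift /turn; case: eqP => // ne1; case: eqP => // ne2.
move: near_xy; rewrite -{1}(unwrapK W x) => /near_wrap[e le_e yE].
have [e1|[e0|e2]] : e = 1%R \/ e = 0%R \/ e = (-1)%R by lia.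
- by case: ne1; rewrite yE e1.
- by rewrite {1}yE e0.
- by case: ne2; rewrite yE e2.
Qed.

Lemma turn_le1 x y : (`|turn x y| <= 1)%R.
Proof. by rewrite /turn; case: ifP => // _; case: ifP. Qed.

Lemma turn_wrapS z : turn (W z) (W (z + 1)%R) = 1%R.
Proof. by rewrite /turn (wrapD _ (unwrapK W (W z))) eqxx. Qed.

Lemma turnxx x : turn x x = 0%R.
Proof.
have E := @wrapD_turn x x (unwrap W x) (nearxx x).
rewrite unwrapK in E; have {}E := E erefl.
have := @wrap_inj_small m W (unwrap W x) (unwrap W x + turn x x)%R.
rewrite -E unwrapK => /(_ erefl).
have := turn_le1 x x.
lia.
Qed.

(** The two ways around the square from [x] to [y'] lift to integers over the same
    point that differ by at most 4.  This is where cycles of length 4, which a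
    square can wrap around, are excluded. *)
Lemma turn_square x y x' y' :
    near x y -> near x x' -> near y y' -> near x' y' ->
  (turn x y + turn y y' = turn x x' + turn x' y')%R.
Proof.
move=> nxy nxx' nyy' nx'y'; have /esym xE := unwrapK W x.
have W1 := wrapD_turn nyy' (wrapD_turn nxy xE).
have W2 := wrapD_turn nx'y' (wrapD_turn nxx' xE).
have := turn_le1 x y; have := turn_le1 y y'.
have := turn_le1 x x'; have := turn_le1 x' y'.
have := wrap_inj_small (etrans (esym W1) W2).
lia.
Qed.

(** The cover makes the closing step from the last point to the first one an
    ordinary summand. *)
Definition winding_number (h : X -> X) : int :=
  (\sum_(0 <= i < m) turn (h (W i)) (h (W i.+1)))%R.

Lemma near_wrapS (i : nat) : near (W i) (W i.+1).
Proof. rewrite -addn1 PoszD; exact: wrap_near. Qed.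

(** By [turn_square] the summands of the two winding numbers differ by the increment
    of the step from [h] to [h'], and the increments telescope around the cycle. *)
Lemma winding_number_homotopy (h h' : X -> X) :
    {homo h : x y / near x y} -> {homo h' : x y / near x y} ->
    (forall x, near (h x) (h' x)) ->
  winding_number h = winding_number h'.
Proof.
move=> h_near h'_near near_hh'; apply/eqP; rewrite -subr_eq0 -sumrB.
pose u i := (- turn (h (W i)) (h' (W i)))%R.
rewrite (eq_bigr (fun i => u i.+1 - u i)%R) => [|i _]; last first.
  have := turn_square (h_near _ _ (near_wrapS i)) (near_hh' _) (near_hh' _)
    (h'_near _ _ (near_wrapS i)).
  rewrite /u; lia.
rewrite telescope_sumr // /u (_ : W m = W 0); first by rewrite subrr.
by apply/eqP; rewrite wrap_eq sub0r dvdzE abszN.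
Qed.

Lemma winding_number_id : winding_number id = m.
Proof.
rewrite /winding_number (eq_bigr (fun=> 1%R)) => [|i _].
  by rewrite big_const_nat iter_addr addr0 subn0 pmulrn intz.
by rewrite -addn1 PoszD turn_wrapS.
Qed.

Lemma winding_number_const x : winding_number (fun=> x) = 0%R.
Proof. by rewrite /winding_number big1 // => i _; rewrite turnxx. Qed.

(** Over the pairs (x, x0) with [x0] fixed, the time parameter of the paths contracts
    the curve to [x0], from winding number [m] to winding number 0. *)
Lemma no_global_section : ~ has_section kappa [set: X * X].
Proof.
case=> s [s_cont s_ends]; pose x0 := W 0.
pose path x := s (exist _ (x, x0) (in_setT (x, x0))).
pose h t x := dpath_at (path x) t.
have h_near t : {homo h t : x y / near x y}.
  move=> x y; case: (x =P y) => [-> | /eqP ne_xy] near_xy; first exact: nearxx.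
  suff: prod_adj kappa (x, x0) (y, x0).
    rewrite /h /path => adj_xy.
    have [->|] := s_cont (exist _ (x, x0) (in_setT (x, x0)))
       (exist _ (y, x0) (in_setT (y, x0))) adj_xy; first exact: nearxx.
    exact: dpath_adj_at.
  by rewrite /prod_adj /= eqxx andbT xpair_eqE eqxx andbT ne_xy.
have numberE t : winding_number (h t) = winding_number (h 0).
  elim: t => // t <-; apply/esym/winding_number_homotopy => // x.
  exact: dpath_at_step.
have h0 : h 0 = id by apply/funext => x; rewrite /h dpath_at0 s_ends.
(* A time by which all these paths have stopped. *)
pose T := \max_x steps (path x).
have hT : h T = fun=> x0.
  apply/funext => x; rewrite /h dpath_at_end ?s_ends //.
  exact: (leq_bigmax x).
have := numberE T; rewrite hT h0 winding_number_id winding_number_const; lia.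
Qed.

Lemma TC_winding : TC kappa X = Some 2.
Proof.
apply: TC_eq => [|[|[|//]] _].
- exact: motion_cover2 W _.
- exact: motion_cover0 (W 0).
- by move/motion_cover1; apply: no_global_section.
Qed.

End WindingNumber.

(** * Simple closed curves *)

(** The given cyclic enumeration, read modulo the number of points, is the cover;
    the prescription of the neighbours gives the lifting of steps. *)
Lemma curve_winding n :
  simple_closed_curve kappa X n.+4 -> inhabited (winding n.+4).
Proof.
case=> f [_ [g gK fK] _ f_nbr].
pose pos (z : int) : 'I_n.+4 := inord `|(z %% n.+4)%Z|.
have posE z : Posz (pos z) = (z %% n.+4)%Z.
  rewrite /pos inordK ?gez0_abs ?modz_ge0 //.
  by rewrite -ltz_nat gez0_abs ?modz_ge0 // ltz_pmod.
have pos_eq z z' : (pos z == pos z') = (n.+4 %| (z' - z)%R)%Z.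
  by rewrite -eqz_mod_dvd -!posE eqz_nat eq_sym.
have posS z : ordS (pos z) = pos (z + 1)%R.
  apply/val_inj/eqP; rewrite -eqz_nat posE /= -modz_nat -addn1 PoszD posE.
  by rewrite modzDml.
have posP z : ord_pred (pos z) = pos (z - 1)%R.
  by rewrite -{1}[z](subrK 1%R) -posS ordSK.
have step z e : (`|e| <= 1)%R -> near (f (pos z)) (f (pos (z + e)%R)).
  move=> le_e; have [->|[->|->]] : e = 1%R \/ e = 0%R \/ e = (-1)%R by lia.
  - by apply/nearP; right; apply/f_nbr; rewrite -posS; right.
  - by rewrite addr0 nearxx.
  - by apply/nearP; right; apply/f_nbr; rewrite -posP; left.
constructor; refine (@Winding n.+4 (fun z => f (pos z)) (fun x => Posz (g x))
  _ _ step _).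
- move=> x; rewrite -[RHS]fK; congr (f _); apply/val_inj/eqP.
  by rewrite -eqz_nat posE modz_nat modn_small.
- by move=> z z'; rewrite (can_eq gK) pos_eq.
move=> z y /nearP[<- | /f_nbr[] ->].
- by exists 0%R; rewrite ?addr0.
- by exists (-1)%R; rewrite // posP.
- by exists 1%R; rewrite // posS.
Qed.

(** Folding the edge over 2, 3 onto the edge over 1, 0 displaces each point by at
    most one step because 3 is adjacent to 4, which lies over the same point as 0. *)
Lemma winding4_retract (W : winding 4) : TC kappa X = Some 1.
Proof.
pose r x := W (if (unwrap W x %% 4)%Z \in [:: 1%R; 2%R] then 1%R else 0%R).
apply: (@TC1_clique_retract (W 0) r) => x; last first.
  by move=> y; rewrite /r; case: ifP => _; case: ifP => _; rewrite ?nearxx //;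
     [rewrite near_sym|]; exact: (@wrap_near _ W 0 1).
have xE : x = W (unwrap W x %% 4)%Z.
  by rewrite -{1}(unwrapK W x); apply/eqP; rewrite wrap_eq -eqz_mod_dvd modz_mod.
rewrite /r; have [] : (0 <= (unwrap W x %% 4)%Z)%R /\ ((unwrap W x %% 4)%Z < 4)%R.
  by rewrite modz_ge0 // ltz_pmod.
move: (unwrap W x %% 4)%Z xE => k -> k_ge0 k_lt4.
have [->|[->|[->|->]]] : k = 0%R \/ k = 1%R \/ k = 2%R \/ k = 3%R by lia.
- exact: nearxx.
- exact: nearxx.
- exact: (@wrap_near _ W 2 (-1)%R).
suff: near (W 3) (W 0) by [].
have <- : W 4 = W 0 by apply/eqP; rewrite wrap_eq.
exact: (@wrap_near _ W 3 1).
Qed.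

Lemma small_curve_clique m : m < 4 -> simple_closed_curve kappa X m ->
  inhabited X /\ forall x y : X, near x y.
Proof.
have clique (a : Z2) : a \in X ->
    (forall z z', z \in X -> z' \in X -> (z == z') || adj kappa z z') ->
    inhabited X /\ forall x y : X, near x y.
  move=> Xa nearX; split; first by exists; exists a.
  by move=> x y; exact: nearX (valP x) (valP y).
case: m => [|[|[|[|//]]]] //= _.
- case=> a defX; apply: (clique a); rewrite defX; first by rewrite !inE.
  by move=> z z'; rewrite !inE => /eqP-> /eqP->; rewrite eqxx.
- case=> a [b [defX ab]]; have ba : adj kappa b a by rewrite adj_sym.
  apply: (clique a); rewrite defX; first by rewrite !inE eqxx.
  by move=> z z'; rewrite !inE => /orP[] /eqP-> /orP[] /eqP->;
     rewrite ?eqxx ?ab ?ba ?orbT.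
case=> a [b [c [defX [ab bc ac]]]].
have ba : adj kappa b a by rewrite adj_sym.
have cb : adj kappa c b by rewrite adj_sym.
have ca : adj kappa c a by rewrite adj_sym.
apply: (clique a); rewrite defX; first by rewrite !inE eqxx.
by move=> z z'; rewrite !inE -!orbA => /or3P[] /eqP-> /or3P[] /eqP->;
   rewrite ?eqxx ?ab ?bc ?ac ?ba ?cb ?ca ?orbT.
Qed.

End MotionPlanning.

Theorem theorem3p5 (kappa : adjacency) (m : nat) (C : {fset Z2})
    (m_gt0 : 0 < m)
    (C_curve : simple_closed_curve kappa C m)
    (C_conn : image_connected kappa C) :
  (m < 5 -> TC kappa C = Some 1) /\ (5 < m -> TC kappa C = Some 2).
Proof.
case: (ltnP m 4) => [lt_m4 | le_4m].
  have [[x0] clique] := small_curve_clique lt_m4 C_curve.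
  split=> [_ | ]; last by lia.
  exact: (@TC1_clique_retract _ _ x0 id).
case: m le_4m C_curve {m_gt0} => [|[|[|[|n]]]] // _ /curve_winding[W].
split=> [lt_n | lt_n]; last by apply: (TC_winding W); lia.
by case: n W lt_n => // W _; apply: winding4_retract W.
Qed.
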